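(* Let $\varphi_1:(\mathbb{R}^n,0)\to(\mathbb{R}^n,0)$ be an involution, let $F:(\mathbb{R}^n,0)\to(\mathbb{R}^n,0)$ be a $\varphi_1$-reversible germ of diffeomorphism, and put $\varphi_2=\varphi_1\circ F$ (so $\varphi_2$ is an involution and $F=\varphi_1\circ\varphi_2$). For integers $k\ge 1$ let $$\varphi_k=\varphi_2\circ F^{k-2},\qquad \varphi_k'=F^{k-1}\circ\varphi_1 .$$ Then, applying $F$ to the fixed-point submanifolds of these involutions, one obtains the two chains $$\cdots\to \mathrm{Fix}(\varphi_{2k})\to\cdots\to\mathrm{Fix}(\varphi_4)\to\mathrm{Fix}(\varphi_2)\to\mathrm{Fix}(\varphi_2')\to\mathrm{Fix}(\varphi_4')\to\cdots\to\mathrm{Fix}(\varphi_{2k}')\to\cdots$$ and $$\cdots\to \mathrm{Fix}(\varphi_{2k+1})\to\cdots\to\mathrm{Fix}(\varphi_3)\to\mathrm{Fix}(\varphi_1)\to\mathrm{Fix}(\varphi_3')\to\mathrm{Fix}(\varphi_5')\to\cdots\to\mathrm{Fix}(\varphi_{2k+1}')\to\cdots,$$ where $k\ge1$ and each arrow $A\to B$ means $F(A)=B$. That is: $F(\mathrm{Fix}(\varphi_{j+2}))=\mathrm{Fix}(\varphi_j)$ and $F(\mathrm{Fix}(\varphi_j'))=\mathrm{Fix}(\varphi_{j+2}')$ for all $j\ge1$, together with $F(\mathrm{Fix}(\varphi_2))=\mathrm{Fix}(\varphi_2')$ and $F(\mathrm{Fix}(\varphi_1))=\mathrm{Fix}(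\varphi_3')$.
   Context: All maps are germs at $0\in\mathbb{R}^n$ of maps fixing $0$, and sets of points are understood as germs at $0$. $I_n$ is the germ of the identity. An involution is a germ of a diffeomorphism $\varphi:(\mathbb{R}^n,0)\to(\mathbb{R}^n,0)$ with $\varphi\circ\varphi=I_n$. A germ of diffeomorphism $F$ is $\varphi$-reversible if $F\circ\varphi=\varphi\circ F^{-1}$. $\mathrm{Fix}(\varphi)=\{x\in(\mathbb{R}^n,0):\varphi(x)=x\}$; for an involution this is a germ of a smooth submanifold. The formulas for $\varphi_k$ and $\varphi_k'$ are consistent for $k=1,2$, with $\varphi_1'=\varphi_1$. *)

(* Defs.v *)
From HB Require Import structures.
From mathcomp Require Import all_boot all_order all_algebra.
From mathcomp Require Import boolp classical_sets functions reals.
From mathcomp Require Import topology normedtype derive.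
Set Implicit Arguments.
Unset Strict Implicit.
Unset Printing Implicit Defensive.
Import Order.TTheory GRing.Theory Num.Theory.
Import numFieldNormedType.Exports.
Local Open Scope classical_set_scope.
Local Open Scope ring_scope.

(* A germ at 0 of a map (R^n, 0) -> (R^n, 0) is given by a total function on
   'rV[R]_n, whose values away from 0 are irrelevant: equality of germs is
   [germ_eq].  Likewise a germ of a set is given by a set, up to
   [germ_seteq]. *)

Section Germs.
Context {R : realType} {n : nat}.
Local Notation E := 'rV[R]_n.
Implicit Types (f g F G phi : E -> E) (A B U V : set E).

Definition germ_eq f g : Prop := \forall x \near (0 : E), f x = g x.

Definition germ_seteq A B : Prop := \forall x \near (0 : E), A x <-> B x.

(* For k > 0, f is C^k on the open set U iff f is differentiable on U and its
   differential is C^(k-1); in finite dimension the latter means that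
   x |-> 'd f x v = 'D_v f x is C^(k-1) for each fixed v. *)
Fixpoint Ck_on (k : nat) U f : Prop :=
  match k with
  | 0 => forall x, U x -> {for x, continuous f}
  | k'.+1 => (forall x, U x -> differentiable f x) /\
             (forall v : E, Ck_on k' U ('D_v f))
  end.

Definition germ_smooth f : Prop :=
  exists U, [/\ open U, U 0 & forall k, Ck_on k U f].

Definition germ_inverse F G : Prop :=
  [/\ G 0 = 0, germ_smooth G, germ_eq (G \o F) idfun & germ_eq (F \o G) idfun].

Definition germ_diffeo F : Prop :=
  [/\ F 0 = 0, germ_smooth F & exists G, germ_inverse F G].

(* A representative of the inverse germ, which is unique up to [germ_eq]; the
   default value is only taken when F is not a germ of diffeomorphism. *)
Definition germ_inv F : E -> E :=
  if pselect (exists G, germ_inverse F G) is left exG then sval (cid exG)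
  else idfun.

Definition germ_zpow F (z : int) : E -> E :=
  match z with
  | Posz m => iter m F
  | Negz m => iter m.+1 (germ_inv F)
  end.

Definition germ_involution phi : Prop :=
  germ_diffeo phi /\ germ_eq (phi \o phi) idfun.

Definition germ_reversible phi F : Prop :=
  germ_eq (F \o phi) (phi \o germ_inv F).

Definition Fix phi : set E := [set x | phi x = x].

(* F(A) = B as germs of sets.  Only points of A close to 0 may be taken into
   account, since the representative F could send faraway points near 0. *)
Definition germ_image F A B : Prop :=
  exists2 V, nbhs (0 : E) V &
    forall U, nbhs (0 : E) U -> U `<=` V -> germ_seteq (F @` (A `&` U)) B.

End Germs.

(* Main.v *)
Require Import Defs.
From HB Require Import structures.
From mathcomp Require Import all_boot all_order all_algebra.
From mathcomp Require Import boolp classical_sets functions reals.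
From mathcomp Require Import topology normedtype derive.
From mathcomp Require Import landau zify.
Set Implicit Arguments.
Unset Strict Implicit.
Unset Printing Implicit Defensive.
Import Order.TTheory GRing.Theory Num.Theory.
Import numFieldNormedType.Exports.
Local Open Scope classical_set_scope.
Local Open Scope ring_scope.

(** Write [T z] for the germ F^z.  Germs of diffeomorphisms form a group, and
    in it reversibility says that conjugation by [phi1] inverts F, hence sends
    each power to its opposite: [T z \o phi1 = phi1 \o T (- z)]
    ([germ_zpow_conj]).  So F and [phi1] generate a quotient of the infinite
    dihedral group, whose reflections are the maps [reversor phi1 F z], that
    is [phi1 \o T z]; each of them squares to the identity ([reversorK]).
    Both families of involutions of the theorem are made of such reflections:
    phi_k is the one with exponent k - 1, and phi'_k the one with exponent
    1 - k.

    The single relation [F \o reversor (z + 2) = reversor z \o F]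
    ([reversor_shift]) then says that F conjugates the reflection of exponent
    z + 2 to that of exponent z, so it carries the fixed points of the former
    onto those of the latter ([germ_image_Fix]).  The two chains of the theorem
    are the odd and the even exponents in decreasing order; they pass from the
    phi_k to the phi'_k at exponent 1 -> -1 and at exponent 0 -> -2.

    The analytic input is that these composites are again germs of
    diffeomorphisms.  Since a smooth inverse is part of the definition of a
    germ of diffeomorphism, only the stability of C^k maps under composition is
    at stake ([Ck_on_comp]).  It follows by induction on k from the chain rule
    in coordinates, D_v (f o g) = sum_i (D_v g)_i (D_(e_i) f) o g, because C^k
    maps are closed under sums and under products by coordinate functions. *)

(** * Differentiability and maps of class C^k *)

Lemma near_eq_differentiable (R : numFieldType) (V W : normedModType R)
    (f g : V -> W) (x : V) :
  (\forall y \near x, f y = g y) -> differentiable f x -> differentiable g x.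
Proof.
move=> fg df; have /diff_locallyP[dfc dfE] := df.
have gE : g \o shift x = cst (g x) + 'd f x +o_ 0 id.
  apply/eqaddoP => e e0; move/eqaddoP/(_ e e0): dfE.
  move: (fg); rewrite (near_shift 0) => fgx.
  apply: filterS2 fgx => y /=; rewrite subr0 => fgy.
  have <- : f x = g x by exact: nbhs_singleton fg.
  by rewrite !fctE /= fgy.
by apply/diff_locallyP; rewrite (diff_unique dfc gE).
Qed.

Section Ck.
Context {R : realType} {n : nat}.
Local Notation E := 'rV[R]_n.
Implicit Types (f g h : E -> E) (U V : set E) (k : nat).

(** The formulas for directional derivatives only hold where the maps are
    differentiable, so the iterated derivatives have to be compared on U
    alone; U must be open for such an equality to survive differentiation. *)
Lemma Ck_on_ext k U f g : open U -> (forall x, U x -> f x = g x) ->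
  Ck_on k U f -> Ck_on k U g.
Proof.
move=> oU; elim: k f g => [|k IH] f g fg /=.
- move=> cf x Ux; have fgx : \forall y \near x, f y = g y.
    by apply: filterS (open_nbhs_nbhs (conj oU Ux)) => y /fg.
  suff : g @ x --> f x by rewrite (fg x Ux).
  exact: (cvg_trans (near_eq_cvg fgx) (cf x Ux)).
- have fgx x : U x -> \forall y \near x, f y = g y.
    by move=> Ux; apply: filterS (open_nbhs_nbhs (conj oU Ux)) => y /fg.
  case=> df Df; split=> [x Ux|v].
    exact: near_eq_differentiable (fgx x Ux) (df x Ux).
  by apply: IH (Df v) => x Ux; apply/near_eq_derive/fgx.
Qed.

Lemma Ck_on_subset k U V f : U `<=` V -> Ck_on k V f -> Ck_on k U f.
Proof.
move=> UV; elim: k f => [|k IH] f /=; first by move=> cf x /UV; exact: cf.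
by case=> df Df; split=> [x /UV|v]; [exact: df|exact/IH/Df].
Qed.

Lemma Ck_on_pred k U f : Ck_on k.+1 U f -> Ck_on k U f.
Proof.
elim: k f => [|k IH] f /= [df Df]; last by split=> // v; exact/IH/Df.
by move=> x Ux; apply/differentiable_continuous/df.
Qed.

Lemma Ck_on_cst k U (c : E) : Ck_on k U (cst c).
Proof.
elim: k c => [|k IH] c /=; first by move=> x _; exact: cst_continuous.
split=> [x _|v]; first exact: differentiable_cst.
rewrite (_ : 'D_v (cst c) = cst 0); first exact: IH.
by apply/funext => x; exact: derive_cst.
Qed.

Lemma Ck_on_id k U : Ck_on k U idfun.
Proof.
case: k => [|k] /=; first by move=> x _; exact: cvg_id.
split=> [x _|v]; first exact: ex_diff.
rewrite (_ : 'D_v idfun = cst v); first exact: Ck_on_cst.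
by apply/funext => x; exact: derive_id.
Qed.

Lemma Ck_onD k U f g : open U ->
  Ck_on k U f -> Ck_on k U g -> Ck_on k U (f + g).
Proof.
move=> oU; elim: k f g => [|k IH] f g /=.
  by move=> cf cg x Ux; apply: continuousD; [exact: cf|exact: cg].
move=> [df Df] [dg Dg]; split=> [x Ux|v].
  by apply: differentiableD; [exact: df|exact: dg].
apply: Ck_on_ext (IH _ _ (Df v) (Dg v)) => // x Ux.
by rewrite deriveD//; apply: diff_derivable; [exact: df|exact: dg].
Qed.

(** Written out in the canonical basis, the product becomes a sum of products
    of real-valued functions by constant vectors. *)
Lemma differentiable_coordZ (i : 'I_n) f g (x : E) :
  differentiable f x -> differentiable g x ->
  differentiable (fun y => f y 0 i *: g y) x.
Proof.
move=> df dg.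
have coord h j : differentiable h x -> differentiable (fun y => h y 0 j : R) x.
  by move=> dh; exact: (differentiable_comp dh (differentiable_coord _ _ _)).
rewrite (_ : (fun _ => _) =
    \sum_j (fun y => (f y 0 i * g y 0 j) *: delta_mx 0 j)); last first.
  apply/funext => y; rewrite fct_sumE [in LHS](row_sum_delta (g y)) scaler_sumr.
  by apply: eq_bigr => j _; rewrite scalerA.
apply: differentiable_sum => j; apply: differentiableZl.
by apply: differentiableM; exact: coord.
Qed.

Lemma derive_coordZ (i : 'I_n) f g (x v : E) :
  differentiable f x -> differentiable g x ->
  'D_v (fun y => f y 0 i *: g y) x =
  'D_v f x 0 i *: g x + f x 0 i *: 'D_v g x.
Proof.
move=> df dg; have dfg := differentiable_coordZ i df dg.
have der h : differentiable h x -> derivable h x v by exact: diff_derivable.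
have coord h j : differentiable h x -> derivable (fun y => h y 0 j : R) x v.
  by move=> /der /derivable_mxP.
rewrite (derive_mx (der _ dfg)) (derive_mx (der _ df)) (derive_mx (der _ dg)).
apply/rowP => j.
rewrite !mxE (_ : (fun y => (f y 0 i *: g y) 0 j) =
  (fun y => f y 0 i : R) * (fun y => g y 0 j : R)); last first.
  by apply/funext => y; rewrite mxE.
rewrite deriveM; [|exact: coord|exact: coord].
by rewrite addrC; congr (_ + _); exact: mulrC.
Qed.

Lemma Ck_on_coordZ k U (i : 'I_n) f g : open U ->
  Ck_on k U f -> Ck_on k U g -> Ck_on k U (fun x => f x 0 i *: g x).
Proof.
move=> oU; elim: k f g => [|k IH] f g.
  move=> cf cg x Ux; apply: continuousZ; last exact: cg.
  apply: (@continuous_comp _ _ _ f (fun M : E => M 0 i)); first exact: cf.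
  exact: coord_continuous.
move=> Cf Cg; have [df Df] := Cf; have [dg Dg] := Cg.
split=> [x Ux|v]; first by apply: differentiable_coordZ; [exact: df|exact: dg].
apply: (@Ck_on_ext _ _ ((fun x => 'D_v f x 0 i *: g x) +
                        (fun x => f x 0 i *: 'D_v g x))) => // [x Ux|].
  by rewrite derive_coordZ//; [exact: df|exact: dg].
apply: Ck_onD => //.
  by apply: IH; [exact: Df|exact: Ck_on_pred].
by apply: IH; [exact: Ck_on_pred|exact: Dg].
Qed.

(** Contracting the differential of f against the coordinates of the
    derivative of g expresses the chain rule with directional derivatives of f
    in fixed directions only, the form on which the recursive definition of
    class C^k operates. *)
Lemma derive_comp_coord f g (x v : E) :
  differentiable g x -> differentiable f (g x) ->
  'D_v (f \o g) x = \sum_i 'D_v g x 0 i *: 'D_(delta_mx 0 i) f (g x).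
Proof.
move=> dg df; rewrite deriveE; last exact: differentiable_comp.
have -> : 'd (f \o g) x v = 'd f (g x) ('D_v g x).
  rewrite (deriveE v dg) -[RHS]/(('d f (g x) \o 'd g x) v).
  by rewrite -(diff_comp dg df).
rewrite {1}(row_sum_delta ('D_v g x)) linear_sum.
by apply: eq_bigr => i _; rewrite linearZZ (deriveE _ df).
Qed.

(** The derivative of the composite is a combination of [D_v g], of class
    C^(k-1), and of the [D_(e_i) f \o g], which are C^(k-1) by induction since
    g is in particular of class C^(k-1). *)
Lemma Ck_on_comp k U V f g : open U -> (forall x, U x -> V (g x)) ->
  Ck_on k V f -> Ck_on k U g -> Ck_on k U (f \o g).
Proof.
move=> oU UV; elim: k f g UV => [|k IH] f g UV.
  move=> cf cg x Ux; apply: continuous_comp; first exact: cg.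
  exact/cf/UV.
move=> [df Df] Cg; have [dg Dg] := Cg; split=> [x Ux|v].
  by apply: differentiable_comp; [exact: dg|exact/df/UV].
apply: (@Ck_on_ext _ _
  (\sum_i (fun x => 'D_v g x 0 i *: ('D_(delta_mx 0 i) f \o g) x))) => //.
  move=> x Ux; rewrite fct_sumE derive_comp_coord//; first exact: dg.
  exact/df/UV.
elim/big_ind: _ => [|a b|i _]; first exact: Ck_on_cst.
  exact: Ck_onD.
apply: Ck_on_coordZ => //; first exact: Dg.
by apply: IH => //; [exact: Df|exact: Ck_on_pred].
Qed.

End Ck.

(** * The group of germs of diffeomorphisms *)

Section Germ.
Context {R : realType} {n : nat}.
Local Notation E := 'rV[R]_n.
Implicit Types (a b f g h F G phi : E -> E) (z : int).

(** As the filter of neighbourhoods of 0 contains 0 in all its members, this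
    convergence forces f 0 = 0; it is exactly what lets an equality of germs be
    composed with f on the right. *)
Definition germ_cont f : Prop := f @ (0 : E) --> (0 : E).

Lemma germ_eq_refl f : germ_eq f f.
Proof. exact: (nearW (F := nbhs (0 : E))). Qed.

Lemma germ_eq_sym f g : germ_eq f g -> germ_eq g f.
Proof. by apply: filterS. Qed.

Lemma germ_eq_trans f g h : germ_eq f g -> germ_eq g h -> germ_eq f h.
Proof. by apply: filterS2 => x ->. Qed.

Lemma germ_eq_compl h f g : germ_eq f g -> germ_eq (h \o f) (h \o g).
Proof. by apply: filterS => x /= ->. Qed.

Lemma germ_eq_compr h f g :
  germ_cont h -> germ_eq f g -> germ_eq (f \o h) (g \o h).
Proof. by move=> h0; exact: h0. Qed.

Lemma germ_smooth_comp f g :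
  g 0 = 0 -> germ_smooth f -> germ_smooth g -> germ_smooth (f \o g).
Proof.
move=> g0 [V [oV V0 Cf]] [U [oU U0 Cg]].
have oUV : open (U `&` g @^-1` V).
  rewrite openE => x [Ux Vgx]; apply: filterI.
    exact: open_nbhs_nbhs (conj oU Ux).
  exact: (Cg 0%N x Ux) (open_nbhs_nbhs (conj oV Vgx)).
exists (U `&` g @^-1` V); split=> // [|k]; first by split=> //=; rewrite g0.
by apply: Ck_on_comp (Cf k) (Ck_on_subset _ (Cg k)) => // x [].
Qed.

Lemma germ_smooth_id : germ_smooth (idfun : E -> E).
Proof. by exists setT; split=> // [|k]; [exact: openT|exact: Ck_on_id]. Qed.

Lemma germ_smooth_cont f : f 0 = 0 -> germ_smooth f -> germ_cont f.
Proof.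
move=> f0 [U [_ U0 /(_ 0%N 0 U0) cf]].
by have : f @ (0 : E) --> f 0 := cf; rewrite f0.
Qed.

Lemma germ_diffeo_cont F : germ_diffeo F -> germ_cont F.
Proof. by case=> F0 sF _; exact: germ_smooth_cont. Qed.

Lemma germ_invP F : germ_diffeo F -> germ_inverse F (germ_inv F).
Proof.
by case=> _ _ exG; rewrite /germ_inv; case: pselect => // p; exact: svalP.
Qed.

Lemma germ_diffeo_inv F : germ_diffeo F -> germ_diffeo (germ_inv F).
Proof.
move=> dF; have [F0 sF _] := dF; have [G0 sG GF FG] := germ_invP dF.
by split=> //; exists F.
Qed.

Lemma germ_diffeo_id : germ_diffeo (idfun : E -> E).
Proof.
split=> //; first exact: germ_smooth_id.
by exists idfun; split=> //; [exact: germ_smooth_id|exact: germ_eq_refl..].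
Qed.

Lemma germ_diffeo_comp f g :
  germ_diffeo f -> germ_diffeo g -> germ_diffeo (f \o g).
Proof.
move=> df dg; have [f0 sf _] := df; have [g0 sg _] := dg.
have [f'0 sf' f'f ff'] := germ_invP df; have [g'0 sg' g'g gg'] := germ_invP dg.
split; [by rewrite /= g0|exact: germ_smooth_comp|].
exists (germ_inv g \o germ_inv f); split.
- by rewrite /= f'0.
- exact: germ_smooth_comp.
- apply: germ_eq_trans g'g.
  exact: germ_eq_compl (germ_eq_compr (germ_diffeo_cont dg) f'f).
- apply: germ_eq_trans ff'.
  by apply: germ_eq_compl (germ_eq_compr _ gg'); exact: germ_smooth_cont.
Qed.

Lemma germ_diffeo_iter F m : germ_diffeo F -> germ_diffeo (iter m F).
Proof.
move=> dF; elim: m => [|m IH]; first exact: germ_diffeo_id.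
exact: germ_diffeo_comp.
Qed.

Lemma germ_diffeo_zpow F z : germ_diffeo F -> germ_diffeo (germ_zpow F z).
Proof.
by case: z => m dF; apply: germ_diffeo_iter => //; exact: germ_diffeo_inv.
Qed.

(** The powers are iterates of F or of its inverse according to the sign of
    the exponent; F cancels one inverse when the exponent is negative. *)
Lemma germ_zpowSl F z : germ_diffeo F ->
  germ_eq (germ_zpow F (z + 1)) (F \o germ_zpow F z).
Proof.
move=> dF; have [_ _ _ FG] := germ_invP dF; apply: germ_eq_sym.
case: z => [m|[|m]]; first by rewrite -PoszD addn1; exact: germ_eq_refl.
  exact: FG.
rewrite (_ : Negz m.+1 + 1 = Negz m); last by lia.
apply: (germ_eq_compr (h := iter m.+1 (germ_inv F)) _ FG).
exact/germ_diffeo_cont/germ_diffeo_iter/germ_diffeo_inv.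
Qed.

Lemma germ_zpowSr F z : germ_diffeo F ->
  germ_eq (germ_zpow F (z + 1)) (germ_zpow F z \o F).
Proof.
move=> dF; have [_ _ GF _] := germ_invP dF; apply: germ_eq_sym.
case: z => [m|[|m]].
- rewrite -PoszD addn1.
  by apply: (nearW (F := nbhs (0 : E))) => x; rewrite /= -iterSr.
- exact: GF.
- rewrite (_ : Negz m.+1 + 1 = Negz m); last by lia.
  apply: filterS GF => x /= GFx.
  by rewrite -[germ_inv F (iter m _ _)]/(iter m.+1 _ _) -iterS iterSr GFx.
Qed.

Lemma germ_zpowNK F z : germ_diffeo F ->
  germ_eq (germ_zpow F (- z) \o germ_zpow F z) idfun.
Proof.
move=> dF; have step y : germ_eq
    (germ_zpow F (- (y + 1)) \o germ_zpow F (y + 1))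
    (germ_zpow F (- y) \o germ_zpow F y).
  apply: germ_eq_trans (germ_eq_compl _ (germ_zpowSl y dF)) _.
  rewrite [in X in germ_eq _ X](_ : - y = - (y + 1) + 1); last by lia.
  apply: germ_eq_compr (germ_eq_sym (germ_zpowSr _ dF)).
  exact/germ_diffeo_cont/germ_diffeo_zpow.
elim: z => [|m IH|m IH]; first exact: germ_eq_refl.
  by apply: germ_eq_trans IH; rewrite intS addrC.
apply: germ_eq_trans IH; apply: germ_eq_sym.
by rewrite (_ : - m%:Z = - m.+1%:Z + 1); [exact: step|lia].
Qed.

Lemma germ_eq_cancel F a b : germ_diffeo F -> germ_cont a -> germ_cont b ->
  germ_eq (F \o a) (F \o b) -> germ_eq a b.
Proof.
move=> dF a0 b0; have [_ _ GF _] := germ_invP dF.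
have GFK c : germ_cont c -> \forall x \near (0 : E), germ_inv F (F (c x)) = c x.
  by move=> c0; exact: c0 _ GF.
move=> Fab; apply: filterS3 (GFK a a0) (GFK b b0) Fab => x /= GFa GFb Fabx.
by rewrite -GFa Fabx GFb.
Qed.

(** For y near 0 put x = F^-1 y.  Since F a = b F, the point F (a x) is b y; so
    b y = y amounts to F (a x) = F x, and by injectivity of F near 0 to
    a x = x. *)
Lemma germ_image_Fix F a b : germ_diffeo F -> germ_cont a ->
  germ_eq (F \o a) (b \o F) -> germ_image F (Fix a) (Fix b).
Proof.
move=> dF a0 Fab; have [G0 sG GF FG] := germ_invP dF.
have Gc := germ_smooth_cont G0 sG.
pose V := [set x | germ_inv F (F x) = x /\ F (a x) = b (F x)].
have nV : nbhs (0 : E) V by apply: filterS2 GF Fab => x; split.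
exists V => // U nU UV.
(* a (F^-1 y) has to lie in V too, for F to be injective at that point. *)
have near_aG : \forall y \near (0 : E), V (a (germ_inv F y)).
  exact: (Gc _ (a0 _ nV)).
have near_G : \forall y \near (0 : E), U (germ_inv F y).
  exact: (Gc _ nU).
apply: filterS3 FG near_G near_aG => y /= FGy UGy [GFaGy _]; split.
  case=> x [ax Ux] <-; have [_ FaxE] := UV _ Ux.
  by rewrite /Fix /= -FaxE (ax : a x = x).
move=> byy; exists (germ_inv F y) => //; split=> //.
have [_ FaE] := UV _ UGy.
by rewrite /Fix /= -GFaGy FaE FGy (byy : b y = y).
Qed.

Lemma germ_involution_eq f g : germ_diffeo f -> germ_eq f g ->
  germ_eq (g \o g) idfun -> germ_involution f.
Proof.
move=> df fg gg; split=> //; apply: germ_eq_trans gg.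
apply: germ_eq_trans (germ_eq_compr (germ_diffeo_cont df) fg) _.
exact: germ_eq_compl.
Qed.

(** * Reversing involutions *)

(** All the involutions of the theorem, indexed by one integer: the reflections
    of the dihedral group generated by phi and F. *)
Definition reversor phi F z : E -> E := phi \o germ_zpow F z.

Section Reversible.
Context {phi F : E -> E}.
Hypothesis phi_invol : germ_involution phi.
Hypothesis F_diffeo : germ_diffeo F.
Hypothesis F_rev : germ_reversible phi F.

Local Notation sigma := (reversor phi F).

Let Tc z : germ_cont (germ_zpow F z).
Proof. exact/germ_diffeo_cont/germ_diffeo_zpow. Qed.

(** As functions of z, both sides satisfy the recurrence X (z + 1) = F X z, the
    right-hand one because phi F^-1 = F phi; they agree at z = 0.  As F is
    invertible, the recurrence can be followed in both directions. *)
Lemma germ_zpow_conj z :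
  germ_eq (germ_zpow F z \o phi) (phi \o germ_zpow F (- z)).
Proof.
have [dphi _] := phi_invol; have [_ _ GF _] := germ_invP F_diffeo.
have phic := germ_diffeo_cont dphi.
pose L y := germ_zpow F y \o phi; pose M y := phi \o germ_zpow F (- y).
have LS y : germ_eq (L (y + 1)) (F \o L y).
  exact: germ_eq_compr phic (germ_zpowSl y F_diffeo).
have MS y : germ_eq (M (y + 1)) (F \o M y).
  have GT : germ_eq (germ_zpow F (- (y + 1))) (germ_inv F \o germ_zpow F (- y)).
    rewrite [in X in germ_eq _ X](_ : - y = - (y + 1) + 1); last by lia.
    apply: germ_eq_sym.
    apply: germ_eq_trans (germ_eq_compl _ (germ_zpowSl _ F_diffeo)) _.
    exact: germ_eq_compr (Tc _) GF.
  apply: germ_eq_trans (germ_eq_compl phi GT) _.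
  exact: germ_eq_compr (Tc _) (germ_eq_sym F_rev).
have up y : germ_eq (L y) (M y) -> germ_eq (L (y + 1)) (M (y + 1)).
  move=> LM; apply: germ_eq_trans (LS y) _.
  exact: germ_eq_trans (germ_eq_compl F LM) (germ_eq_sym (MS y)).
have down y : germ_eq (L (y + 1)) (M (y + 1)) -> germ_eq (L y) (M y).
  move=> LM; apply: germ_eq_cancel F_diffeo _ _ _.
  - exact/germ_diffeo_cont/germ_diffeo_comp/dphi/germ_diffeo_zpow.
  - exact/germ_diffeo_cont/germ_diffeo_comp/germ_diffeo_zpow.
  - apply: germ_eq_trans (germ_eq_sym (LS y)) _.
    exact: germ_eq_trans LM (MS y).
rewrite -/(L z) -/(M z); elim: z => [|m IH|m IH]; first exact: germ_eq_refl.
  by rewrite intS addrC; exact: up.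
by apply: down; rewrite (_ : - m.+1%:Z + 1 = - m%:Z)//; lia.
Qed.

(** phi F^z phi F^z = phi phi F^(-z) F^z. *)
Lemma reversorK z : germ_eq (sigma z \o sigma z) idfun.
Proof.
have [_ phi2] := phi_invol.
have := germ_eq_compl phi (germ_eq_compr (Tc z) (germ_zpow_conj z)).
move=> /germ_eq_trans; apply.
apply: germ_eq_trans (germ_zpowNK z F_diffeo).
apply: (germ_eq_compr (h := germ_zpow F (- z) \o germ_zpow F z)) phi2.
apply/germ_diffeo_cont/germ_diffeo_comp; exact: germ_diffeo_zpow.
Qed.

(** F phi F^(z+2) = phi F^-1 F^(z+2) = phi F^z F: crossing phi turns F into its
    inverse, which accounts for a shift of the exponent by two. *)
Lemma reversor_shift z :
  germ_eq (F \o sigma (z + 2)) (sigma z \o F).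
Proof.
have [_ _ GF _] := germ_invP F_diffeo.
apply: germ_eq_trans (germ_eq_compr (Tc _) F_rev) _.
apply: germ_eq_trans (germ_eq_compl phi (germ_zpowSr z F_diffeo)).
apply: (germ_eq_compl phi).
rewrite (_ : z + 2 = z + 1 + 1); last by lia.
apply: germ_eq_trans (germ_eq_compl _ (germ_zpowSl _ F_diffeo)) _.
exact: germ_eq_compr GF.
Qed.

Lemma germ_involution_reversor z f :
  germ_diffeo f -> germ_eq f (sigma z) -> germ_involution f.
Proof.
by move=> df /germ_involution_eq; apply=> //; exact: reversorK.
Qed.

Lemma germ_image_Fix_reversor z a b : germ_diffeo a ->
  germ_eq a (sigma (z + 2)) -> germ_eq b (sigma z) ->
  germ_image F (Fix a) (Fix b).
Proof.
move=> da aE bE; apply: germ_image_Fix => //; first exact: germ_diffeo_cont.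
apply: germ_eq_trans (germ_eq_compl F aE) _.
apply: germ_eq_trans (reversor_shift z) _.
exact: germ_eq_compr (germ_diffeo_cont F_diffeo) (germ_eq_sym bE).
Qed.

End Reversible.
End Germ.

Theorem theorem2p8 (R : realType) (n : nat)
    (phi1 F : 'rV[R]_n -> 'rV[R]_n)
    (phi1_invol : germ_involution phi1)
    (F_diffeo : germ_diffeo F)
    (F_rev : germ_reversible phi1 F) :
  let phi2 := phi1 \o F in
  let phi (k : nat) := phi2 \o germ_zpow F (k%:Z - 2) in
  let phi' (k : nat) := germ_zpow F (k%:Z - 1) \o phi1 in
  [/\ germ_involution phi2 /\ germ_eq F (phi1 \o phi2),
      [/\ germ_eq (phi 1%N) phi1, germ_eq (phi 2%N) phi2
        & germ_eq (phi' 1%N) phi1],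
      forall k : nat, (1 <= k)%N ->
        germ_involution (phi k) /\ germ_involution (phi' k),
      forall j : nat, (1 <= j)%N ->
        germ_image F (Fix (phi (j + 2)%N)) (Fix (phi j)) /\
        germ_image F (Fix (phi' j)) (Fix (phi' (j + 2)%N))
    & germ_image F (Fix (phi 2%N)) (Fix (phi' 2%N)) /\
      germ_image F (Fix (phi 1%N)) (Fix (phi' 3%N))].
Proof.
move=> phi2 phi phi'; have [dphi1 phi1K] := phi1_invol.
have dphi2 : germ_diffeo phi2 by exact: germ_diffeo_comp.
have dphi k : germ_diffeo (phi k).
  exact/germ_diffeo_comp/germ_diffeo_zpow.
have dphi' k : germ_diffeo (phi' k).
  exact/germ_diffeo_comp/dphi1/germ_diffeo_zpow.
have phiE k : germ_eq (phi k) (reversor phi1 F (k%:Z - 1)).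
  rewrite (_ : k%:Z - 1 = k%:Z - 2 + 1); last by lia.
  exact: (germ_eq_compl phi1 (germ_eq_sym (germ_zpowSl (k%:Z - 2) F_diffeo))).
have phi'E k : germ_eq (phi' k) (reversor phi1 F (1 - k%:Z)).
  by rewrite -opprB; exact: germ_zpow_conj.
have invol := germ_involution_reversor phi1_invol F_diffeo F_rev.
have chain z a b (da : germ_diffeo a) :=
  germ_image_Fix_reversor F_diffeo F_rev (z := z) (b := b) da.
split.
- split; first exact: (invol 1 _ dphi2 (germ_eq_refl _)).
  exact: germ_eq_compr (germ_diffeo_cont F_diffeo) (germ_eq_sym phi1K).
- by split; [exact: (phiE 1%N)|exact: germ_eq_refl..].
- move=> k _; split; first exact: invol _ _ _ (phiE k).
  exact: invol _ _ _ (phi'E k).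
- move=> j _; split.
    apply: (chain _ _ _ (dphi _) _ (phiE j)).
    by rewrite (_ : _ + 2 = (j + 2)%N%:Z - 1); [exact: phiE|lia].
  apply: (chain _ _ _ (dphi' _) _ (phi'E (j + 2)%N)).
  by rewrite (_ : _ + 2 = 1 - j%:Z); [exact: phi'E|lia].
- split; first exact: chain (- 1) _ _ (dphi 2%N) (phiE 2%N) (phi'E 2%N).
  exact: chain (- 2) _ _ (dphi 1%N) (phiE 1%N) (phi'E 3%N).
Qed.
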